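(* Consider a collection of $k\ge 1$ gadget pattern pairs $\{(G_j^a,G_j^r)\mid 1\le j\le k\}$ for a problem $B$ (minimization or maximization) whose objective function is additive with respect to the gadgets. Let the universe be the union of subuniverses $\mathcal U_1,\dots,\mathcal U_m$ for the collection (where the number $m$ of subuniverses can be chosen arbitrarily large), and assume that, with respect to the subuniverses, the gadget pattern pairs satisfy the consistency condition for $B$, the first item condition, the distinguishing decision condition, and the disjoint copies condition; suppose also that the values $\mathrm{OPT}(G_j^a),\mathrm{BAD}(G_j^a),\mathrm{OPT}(G_j^r),\mathrm{BAD}(G_j^r)$ are independent of $j$ and $\mathrm{OPT}(G_j^r)\ge\mathrm{OPT}(G_j^a)$. Let $s$ be the maximum number of input items in any gadget pattern in the collection. Then any optimal adaptive priority algorithm with advice for $B$ in the oblivious priority function model must use at least $\lfloor n/s\rfloor$ advice bits on worst case instances with $n$ input items.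
   Context: **Adaptive priority algorithm with advice.** There is a universe $\mathcal U$ of input items; an input is a finite multiset $X$ of items. An oracle that knows the algorithm and all of $X$ (and how ties will be broken) writes an infinite binary advice tape. The deterministic algorithm may first read some bits of the tape, sequentially. Then, in iteration $i=1,2,\dots$ until $X$ is empty, it specifies a priority function $P_i:\mathcal U\to\mathbb R$, receives an item $x_i$ of the remaining input $X$ maximizing $P_i$ (ties broken adversarially), which is removed from $X$, reads zero or more further advice bits, and makes an irrevocable decision $d_i$. The decision and the number of bits read are functions of the items received, the advice read and the decisions made so far. Advice used is the number of bits read. The algorithm is optimal if it attains the optimal objective value on every input. *Oblivious priority function model*: $P_i$ may depend on $x_1,\dots,x_{i-1}$ and the advice read so far, but must give the same priority to all input items that are indistinguishable when ignoring names not present in the items already received (e.g., for unweighted graph problems, vertices of the same degree where neither the vertices nor their neighbors have been seen yet get the same priority). **Problem $B$.** A decision (''accept'' or ''reject'') is made for every input item. The objective function assigns to the input items and decisions a value in $\mathbb R\cup\{\pm\infty\}$ ($\pm\infty$ for infeasibility) and is invariant under simultaneous permutation of items and decisions. **Gadgets.** A *gadget* for $B$ is a constant-sized instance of $B$, i.e., a collection of input items satisfying the consistency conditions for $B$ (the conditions for a collection of items to be a valid input; e.g., for a graph problem where an item is a vertex name with a list of neighbor names, $u$ is listed as a neighbor of $v$ iff $v$ is listed as a neighbor of $u$). A *gadget pattern* is a gadget up to renaming of the names occurring in it; a *gadget pattern pair* is a pair $(G^a,G^r)$ of gadget patterns. A *subuniverse* for a collection of gadget pattern pairs is a set of input items over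 its own set of names containing all input items needed for all isomorphic (renamed) copies of all gadget patterns in the collection. Inputs consist of one gadget, consistent with one of the gadget patterns, from each of the subuniverses. - *Consistency condition*: the chosen input items form valid instances of $B$. - *Disjoint copies condition*: the subuniverses are pairwise disjoint and identical up to renaming, so an input item identifies the subuniverse it is in. - *Additivity with respect to the gadgets*: for any instance formed from a set of gadgets from disjoint subuniverses, the objective value on the instance is the sum of the objective values on the individual gadgets. - *First item condition*: the first input item $\mathit{first}(\mathcal U_i)$ that the algorithm receives from a subuniverse $\mathcal U_i$ identifies a gadget pattern pair $(G^a,G^r)$ of the collection, and the item itself gives no information about which of the two patterns it is in (i.e., for the current priority function $P$, it can be the highest-priority item both in a copy of $G^a$ and in a copy of $G^r$ in $\mathcal U_i$). - *Distinguishing decision condition*: the decision on this first item resulting in the optimal objective value in $G^a$ is different from the decision resulting in the optimal objective value in $G^r$; the optimal decision is ''accept'' for $G^a$ and ''reject'' for $G^r$. $\mathrm{OPT}(G)$ is the best objective value on $G$. $\mathrm{BAD}(G)$ is the best objective value attainable on $G$ after making the wrong (non-optimal) decision on the first item of $G$ presented to the algorithm. *)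

(* Defs.v *)
From HB Require Import structures.
From mathcomp Require Import all_boot all_order all_algebra.
From mathcomp Require Import classical_sets reals constructive_ereal ereal.

Set Implicit Arguments.
Unset Strict Implicit.
Unset Printing Implicit Defensive.

Import Order.TTheory GRing.Theory Num.Theory.
Local Open Scope ring_scope.

(* Problems with accept/reject decisions (true = accept).  Input items mention
   finitely many names; [rename f] is only meaningful for bijective f and is
   the action of the permutations of the names on the items.  A collection of
   items is a seq, up to [perm_eq]; an instance with decisions is a seq of
   pairs.  [valid] is the consistency condition of the problem.  The value of
   an infeasible solution is +oo for a minimization problem and -oo for a
   maximization problem; the infinity of the other sign is not a value. *)
Record problem (R : realType) := Problem {
  name : eqType;
  item : eqType;
  names_of : item -> seq name;
  rename : (name -> name) -> item -> item;
  rename_id : forall x, rename id x = x;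
  rename_comp : forall f g x, bijective f -> bijective g ->
    rename (f \o g) x = rename f (rename g x);
  names_rename : forall f x, bijective f ->
    names_of (rename f x) =i map f (names_of x);
  rename_ext : forall f g x, bijective f -> bijective g ->
    {in names_of x, f =1 g} -> rename f x = rename g x;
  valid : seq item -> Prop;
  valid_perm : forall X Y, perm_eq X Y -> valid X -> valid Y;
  minimization : bool;
  obj : seq (item * bool) -> \bar R;
  obj_perm : forall D E, perm_eq D E -> obj D = obj E;
  obj_infeasible : forall D,
    obj D <> (if minimization then -oo else +oo)%E
}.

Definition best (R : realType) (B : problem R) (V : set (\bar R)) : \bar R :=
  if minimization B then ereal_inf V else ereal_sup V.

Definition outcomes (R : realType) (B : problem R) (G : seq (item B))
  : set (\bar R) :=
  [set v | exists2 D : seq (item B * bool),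
             perm_eq (unzip1 D) G & v = obj D]%classic.

Definition OPT (R : realType) (B : problem R) (G : seq (item B)) : \bar R :=
  best B (outcomes G).

(* Values attainable on G when (one occurrence of) x gets the decision b. *)
Definition outcomes_first (R : realType) (B : problem R) (G : seq (item B))
    (x : item B) (b : bool) : set (\bar R) :=
  [set v | exists2 D : seq (item B * bool),
             perm_eq (x :: unzip1 D) G & v = obj ((x, b) :: D)]%classic.

Definition decision_optimal (R : realType) (B : problem R) (G : seq (item B))
    (x : item B) (b : bool) : Prop :=
  best B (outcomes_first G x b) = OPT G.

(* BAD depends on the item x of G that is presented first. *)
Definition BAD (R : realType) (B : problem R) (G : seq (item B)) (x : item B)
  : \bar R :=
  best B [set v | exists2 b, ~ decision_optimal G x b
                           & outcomes_first G x b v]%classic.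

(* In all three fields the arguments are, in this order, the items received,
   the decisions made and the advice bits read so far (each chronologically).
   [more] says whether one more bit is read before going on: it governs the
   initial reading when no item has been received, and otherwise the reading
   between the arrival of the last item received and the decision on it. *)
Record algorithm (R : realType) (B : problem R) := Algorithm {
  priority : seq (item B) -> seq bool -> seq bool -> item B -> R;
  more : seq (item B) -> seq bool -> seq bool -> bool;
  decide : seq (item B) -> seq bool -> seq bool -> bool
}.

(* Chooses one of the tied items, given as the last argument; the choice may
   depend on the whole history. *)
Definition tiebreaker (R : realType) (B : problem R) : Type :=
  seq (item B) -> seq bool -> seq bool -> seq (item B) -> item B.

Definition is_tiebreaker (R : realType) (B : problem R) (T : tiebreaker B)
  : Prop :=
  forall xs ds adv s, s != [::] -> T xs ds adv s \in s.

Definition top_items (R : realType) (B : problem R) (P : item B -> R)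
    (s : seq (item B)) : seq (item B) :=
  [seq x <- s | all (fun y => P y <= P x) s].

(* With p bits of the tape already read, reading stops after bit number q. *)
Definition reads (R : realType) (B : problem R) (A : algorithm B)
    (tape : nat -> bool) (xs : seq (item B)) (ds : seq bool) (p q : nat)
  : Prop :=
  [/\ (p <= q)%N,
      forall l, (p <= l < q)%N -> more A xs ds (mkseq tape l)
    & ~~ more A xs ds (mkseq tape q)].

(* [steps A T tape s xs ds p D q]: from a state with remaining input s, items
   xs received, decisions ds made and p bits read, the execution ends with the
   items and decisions D after having read q bits in total. *)
Inductive steps (R : realType) (B : problem R) (A : algorithm B)
    (T : tiebreaker B) (tape : nat -> bool) :
    seq (item B) -> seq (item B) -> seq bool -> nat ->
    seq (item B * bool) -> nat -> Prop :=
| steps_end xs ds p : steps A T tape [::] xs ds p (zip xs ds) p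
| steps_next s xs ds p x p' D q :
    s != [::] ->
    x = T xs ds (mkseq tape p)
          (top_items (priority A xs ds (mkseq tape p)) s) ->
    reads A tape (rcons xs x) ds p p' ->
    steps A T tape (rem x s) (rcons xs x)
      (rcons ds (decide A (rcons xs x) ds (mkseq tape p'))) p' D q ->
    steps A T tape s xs ds p D q.

Definition run (R : realType) (B : problem R) (A : algorithm B)
    (T : tiebreaker B) (tape : nat -> bool) (X : seq (item B))
    (D : seq (item B * bool)) (bits : nat) : Prop :=
  exists2 p, reads A tape [::] [::] 0 p & steps A T tape X [::] [::] p D bits.

(* The oracle is determined after the algorithm, and knows the input and how
   ties will be broken. *)
Definition oracle (R : realType) (B : problem R) : Type :=
  seq (item B) -> tiebreaker B -> nat -> bool.

Definition optimal (R : realType) (B : problem R) (inputs : set (seq (item B)))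
    (A : algorithm B) (O : oracle B) : Prop :=
  forall X T, inputs X -> is_tiebreaker T ->
    exists D bits, run A T (O X T) X D bits /\ obj D = OPT X.

(* x and y differ only in names not occurring in the items of [seen]. *)
Definition indistinguishable (R : realType) (B : problem R)
    (seen : seq (item B)) (x y : item B) : Prop :=
  exists f : name B -> name B,
    [/\ bijective f,
        forall z a, z \in seen -> a \in names_of z -> f a = a
      & y = rename f x].

Definition oblivious (R : realType) (B : problem R) (universe : set (item B))
    (seen : seq (item B)) (P : item B -> R) : Prop :=
  forall x y, universe x -> universe y -> indistinguishable seen x y ->
    P x = P y.

Definition oblivious_algorithm (R : realType) (B : problem R)
    (universe : set (item B)) (A : algorithm B) : Prop :=
  forall xs ds adv, oblivious universe xs (priority A xs ds adv).

(* A gadget pattern is given by a representative, which must have at least one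
   item (the first one presented). *)
Definition gadget_pattern (R : realType) (B : problem R) (G : seq (item B))
  : Prop :=
  G != [::] /\ forall f, bijective f -> valid (map (rename f) G).

Record pattern_pairs (R : realType) (B : problem R) (k : nat) := PatternPairs {
  pat_a : 'I_k -> seq (item B);
  pat_r : 'I_k -> seq (item B);
  pat_aP : forall j, gadget_pattern (pat_a j);
  pat_rP : forall j, gadget_pattern (pat_r j)
}.

Definition in_collection (R : realType) (B : problem R) (k : nat)
    (C : pattern_pairs B k) (G : seq (item B)) : Prop :=
  exists j, G = pat_a C j \/ G = pat_r C j.

Definition max_pattern_size (R : realType) (B : problem R) (k : nat)
    (C : pattern_pairs B k) : nat :=
  \max_(j < k) maxn (size (pat_a C j)) (size (pat_r C j)).

Definition copy_in (R : realType) (B : problem R) (U : set (item B))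
    (G H : seq (item B)) : Prop :=
  (exists2 f, bijective f & perm_eq H (map (rename f) G)) /\
  (forall x, x \in H -> U x).

(* N is the set of names of the subuniverse U.  The last condition says that N
   is large enough to host the gadgets. *)
Definition subuniverse (R : realType) (B : problem R) (k : nat)
    (C : pattern_pairs B k) (N : set (name B)) (U : set (item B)) : Prop :=
  [/\ forall x a, U x -> a \in names_of x -> N a,
      forall G f, in_collection C G -> bijective f ->
        (forall x a, x \in G -> a \in names_of (rename f x) -> N a) ->
        forall x, x \in G -> U (rename f x)
    & forall G, in_collection C G -> exists H, copy_in U G H].

Definition gadget_in (R : realType) (B : problem R) (k : nat)
    (C : pattern_pairs B k) (U : set (item B)) (H : seq (item B)) : Prop :=
  exists2 G, in_collection C G & copy_in U G H.

Definition union_universe (R : realType) (B : problem R) (m : nat)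
    (U : 'I_m -> set (item B)) : set (item B) :=
  [set x | exists i, U i x]%classic.

Definition one_gadget_each (R : realType) (B : problem R) (k m : nat)
    (C : pattern_pairs B k) (U : 'I_m -> set (item B)) (X : seq (item B))
  : Prop :=
  exists2 H : 'I_m -> seq (item B),
    forall i, gadget_in C (U i) (H i)
  & perm_eq X (flatten [seq H i | i <- enum 'I_m]).

Definition gadget_inputs (R : realType) (B : problem R) (k m : nat)
    (C : pattern_pairs B k) (U : 'I_m -> set (item B))
  : set (seq (item B)) :=
  [set X | valid X /\ one_gadget_each C U X]%classic.

Definition consistency (R : realType) (B : problem R) (k m : nat)
    (C : pattern_pairs B k) (U : 'I_m -> set (item B)) : Prop :=
  forall X, one_gadget_each C U X -> valid X.

Definition disjoint_copies (R : realType) (B : problem R) (m : nat)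
    (N : 'I_m -> set (name B)) (U : 'I_m -> set (item B)) : Prop :=
  [/\ forall i i', i != i' -> (N i `&` N i' = set0)%classic,
      forall i i', i != i' -> (U i `&` U i' = set0)%classic
    & forall i i', exists f : name B -> name B,
        [/\ bijective f, (N i' = f @` N i)%classic
          & (U i' = rename f @` U i)%classic]].

Definition additive (R : realType) (B : problem R) (k m : nat)
    (C : pattern_pairs B k) (U : 'I_m -> set (item B)) : Prop :=
  forall (I : {set 'I_m}) (D : 'I_m -> seq (item B * bool)),
    (forall i, i \in I -> gadget_in C (U i) (unzip1 (D i))) ->
    obj (flatten [seq D i | i <- enum I]) = (\sum_(i in I) obj (D i))%E.

(* P can be the current priority function of an algorithm in the oblivious
   model that has not received an item from U i yet. *)
Definition fresh_priority (R : realType) (B : problem R) (m : nat)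
    (U : 'I_m -> set (item B)) (i : 'I_m) (P : item B -> R) : Prop :=
  exists2 seen : seq (item B),
    forall y, y \in seen -> exists2 i', i' != i & U i' y
  & oblivious (union_universe U) seen P.

(* The pair identified by a first item x is [ident x].  Patterns may be shared
   by several pairs, so the pair is a function of x rather than of the gadget
   containing x. *)
Definition first_item (R : realType) (B : problem R) (k m : nat)
    (C : pattern_pairs B k) (U : 'I_m -> set (item B))
    (ident : item B -> 'I_k) : Prop :=
  forall i P H x, fresh_priority U i P -> gadget_in C (U i) H ->
    x \in top_items P H ->
    [/\ copy_in (U i) (pat_a C (ident x)) H \/
        copy_in (U i) (pat_r C (ident x)) H,
        exists2 Ha, copy_in (U i) (pat_a C (ident x)) Ha
                  & x \in top_items P Ha
      & exists2 Hr, copy_in (U i) (pat_r C (ident x)) Hr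
                  & x \in top_items P Hr].

Definition distinguishing_decision (R : realType) (B : problem R) (k m : nat)
    (C : pattern_pairs B k) (U : 'I_m -> set (item B))
    (ident : item B -> 'I_k) : Prop :=
  forall i P H x, fresh_priority U i P -> x \in top_items P H ->
    (copy_in (U i) (pat_a C (ident x)) H ->
       decision_optimal H x true /\ ~ decision_optimal H x false) /\
    (copy_in (U i) (pat_r C (ident x)) H ->
       decision_optimal H x false /\ ~ decision_optimal H x true).

(* The values OPT and BAD of the patterns are those of their copies in the
   subuniverses and do not depend on the pair. *)
Definition pattern_values (R : realType) (B : problem R) (k m : nat)
    (C : pattern_pairs B k) (U : 'I_m -> set (item B))
    (ident : item B -> 'I_k) (opt_a bad_a opt_r bad_r : \bar R) : Prop :=
  [/\ forall i j H, copy_in (U i) (pat_a C j) H -> OPT H = opt_a,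
      forall i j H, copy_in (U i) (pat_r C j) H -> OPT H = opt_r,
      forall i P H x, fresh_priority U i P -> x \in top_items P H ->
        copy_in (U i) (pat_a C (ident x)) H -> BAD H x = bad_a
    & forall i P H x, fresh_priority U i P -> x \in top_items P H ->
        copy_in (U i) (pat_r C (ident x)) H -> BAD H x = bad_r].

(* Main.v *)
Require Import Defs.
From mathcomp Require Import all_boot all_order all_algebra.
From mathcomp Require Import classical_sets reals constructive_ereal ereal.
From mathcomp Require Import fingroup perm boolp.

(* An input that forces many bits cannot be built along one execution, because
   the oracle's tape depends on the complete input.  Instead, fix one pair of
   patterns (a, r) and count: each subuniverse receives a copy of a or r with
   its names permuted arbitrarily, which gives a set W of possible gadgets per
   subuniverse, and for every fixed tape at most |W|^m / 2^m of the |W|^m inputs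
   are solved optimally.  Since reading fewer than m bits distinguishes at most
   2^(m-1) tapes, some input requires m bits.

   For the count, the first item condition applied to suitable priority
   functions shows that a and r contain the same items up to renaming.  Hence
   the subuniverse from which the next unseen gadget is opened, and its first
   item up to renaming, do not depend on the unseen gadgets, so nothing leaks
   about the gadgets not opened yet.  Among the gadgets in W with a given first
   item, the copies of a and of r are equinumerous, so the decision on it, which
   by additivity has to be optimal for its gadget, is right for at most half of
   W. *)

Section AdviceLowerBound.
Set Implicit Arguments.
Unset Strict Implicit.
Unset Printing Implicit Defensive.
Import Order.TTheory GRing.Theory Num.Theory.

(** * Auxiliary facts on sequences *)

Lemma filter_rem_true (T : eqType) (a : pred T) (x : T) (s : seq T) :
  a x -> [seq y <- rem x s | a y] = rem x [seq y <- s | a y].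
Proof.
move=> ax; elim: s => //= y s IH.
case: eqVneq => [->|yx] /=; first by rewrite ax /= eqxx.
by case: (a y) => //=; rewrite (negPf yx) IH.
Qed.

Lemma filter_rem_false (T : eqType) (a : pred T) (x : T) (s : seq T) :
  ~~ a x -> [seq y <- rem x s | a y] = [seq y <- s | a y].
Proof.
move=> ax; elim: s => //= y s IH.
case: eqVneq => [->|yx] /=; first by rewrite (negPf ax).
by rewrite IH.
Qed.

Lemma has_minimal (T : eqType) (K : T -> nat) (s : seq T) :
  s != [::] -> has (fun x => all (fun y => K x <= K y)%N s) s.
Proof.
elim: s => //= x s IH _; case: (eqVneq s [::]) => [->|/IH]; first by rewrite /= leqnn.
move=> /hasP[z zs zmin]; rewrite leqnn /=.
case: (leqP (K x) (K z)) => xz.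
  apply/orP; left; apply: sub_all zmin => y; exact: leq_trans xz.
apply/orP; right; apply/hasP; exists z => //; by rewrite (ltnW xz).
Qed.

Lemma has_maximal (R : realType) (T : eqType) (P : T -> R) (s : seq T) :
  s != [::] -> has (fun x => all (fun y => P y <= P x)%R s) s.
Proof.
elim: s => //= x s IH _; case: (eqVneq s [::]) => [->|/IH]; first by rewrite /= lexx.
move=> /hasP[z zs zmin]; rewrite lexx /=.
case: (lerP (P z) (P x)) => xz.
  apply/orP; left; apply: sub_all zmin => y yz; exact: le_trans yz xz.
apply/orP; right; apply/hasP; exists z => //; by rewrite (ltW xz).
Qed.

(** * Extension of finite injections to permutations *)

Lemma perm_extend (T : finType) (A : seq T) (f : T -> T) :
  {in A &, injective f} -> exists s : {perm T}, {in A, s =1 f}.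
Proof.
elim: A => [|a A IH] inj; first by exists 1%g.
have [|s sf] := IH.
  by move=> x y xA yA; apply: inj; rewrite inE ?xA ?yA orbT.
case: (boolP (a \in A)) => [aA|aA].
  by exists s => x; rewrite inE => /predU1P[->|]; apply: sf.
(* The transposition corrects the image of [a]. It moves no image of a point of [A], since these
   differ from [s a] and from [f a] by injectivity. *)
exists (s * tperm (s a) (f a))%g => x; rewrite inE permM => /predU1P[->|xA].
  by rewrite tpermL.
rewrite (sf x xA) tpermD //.
  by rewrite -(sf x xA) (inj_eq perm_inj); apply: contraNneq aA => ->.
apply: contraNneq aA => /(inj a x); rewrite !inE eqxx xA orbT.
by move=> /(_ isT isT) ->.
Qed.

(** Permutations of the positions of [S] form a finite group, although names are only an [eqType].
    Here they act on all names and fix those outside [S]. *)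
Definition ext (T : eqType) (S : seq T) (s : 'S_(size S)) (a : T) : T :=
  if insub (index a S) is Some o then tnth (in_tuple S) (s o) else a.

Section Ext.
Variables (T : eqType) (S : seq T).
Hypothesis uS : uniq S.
Implicit Type s : 'S_(size S).

Lemma ext_tnth s o : ext s (tnth (in_tuple S) o) = tnth (in_tuple S) (s o).
Proof.
have -> : ext s (tnth (in_tuple S) o) =
    if insub (val o) is Some o' then tnth (in_tuple S) (s o')
    else tnth (in_tuple S) o.
  rewrite /ext; congr (if insub _ is Some _ then _ else _).
  by rewrite (tnth_nth (tnth (in_tuple S) o)) index_uniq.
by rewrite valK.
Qed.

Lemma in_tnth a : a \in S -> exists o, a = tnth (in_tuple S) o.
Proof. by move=> /(@tnthP _ _ (in_tuple S) a). Qed.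

Lemma ext_out s a : a \notin S -> ext s a = a.
Proof. by move=> aS; rewrite /ext insubF // index_mem (negPf aS). Qed.

Lemma ext_mem s a : a \in S -> ext s a \in S.
Proof. by move=> /in_tnth[o ->]; rewrite ext_tnth; exact: (mem_tnth _ (in_tuple S)). Qed.

Lemma extM s t a : ext (s * t)%g a = ext t (ext s a).
Proof.
case: (boolP (a \in S)) => [/in_tnth[o ->]|aS]; last by rewrite !ext_out.
by rewrite !ext_tnth permM.
Qed.

Lemma ext1 a : ext (1%g : 'S_(size S)) a = a.
Proof.
case: (boolP (a \in S)) => [/in_tnth[o ->]|aS]; last by rewrite !ext_out.
by rewrite ext_tnth perm1.
Qed.

Lemma ext_bij s : bijective (ext s).
Proof.
by exists (ext s^-1%g) => a; rewrite -extM ?mulgV ?mulVg ext1.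
Qed.

Lemma ext_extend (A : seq T) (f : T -> T) : injective f ->
  {subset A <= S} -> {subset map f A <= S} -> exists s, {in A, ext s =1 f}.
Proof.
move=> injf AS fAS.
pose t := in_tuple S.
(* The default [o] of [insubd] is never taken at positions of elements of [A], because their images
   lie in [S]. *)
pose F (o : 'I_(size S)) := insubd o (index (f (tnth t o)) S).
have FE o : tnth t o \in A -> tnth t (F o) = f (tnth t o).
  move=> oA; have fS : f (tnth t o) \in S by apply: fAS; apply: map_f.
  by rewrite (tnth_nth (tnth t o)) val_insubd index_mem fS nth_index.
have [|s sF] := @perm_extend _ [seq o <- enum 'I_(size S) | tnth t o \in A] F.
  move=> o o'; rewrite !mem_filter => /andP[oA _] /andP[o'A _] oo'.
  have : f (tnth t o) = f (tnth t o') by rewrite -!FE // oo'.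
  by move=> /injf/(tuple_uniqP _); apply.
exists s => a aA; have [o ao] := in_tnth (AS _ aA); rewrite ao ext_tnth sF ?FE -?ao //.
by rewrite mem_filter -ao aA mem_enum.
Qed.

End Ext.

(** * Optima of sums of extended reals *)

Section ExtendedSums.
Local Open Scope ereal_scope.
Local Open Scope classical_set_scope.
Variables (R : realType) (I : finType) (V : I -> set (\bar R)) (v : I -> \bar R).
Hypothesis Vv : forall i, V i (v i).

(** Exchange argument. Comparison with values below [+oo] shows that the sum of the [v j] is below
    [+oo], so every [v j] is finite. Replacing [v i] by a smaller element of [V i] would then
    strictly decrease the sum. *)
Lemma minimal_sum : (forall i w, V i w -> w != -oo) ->
  (forall i, ereal_inf (V i) != +oo) ->
  (forall w : I -> \bar R, (forall i, V i (w i)) ->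
     \sum_i v i <= \sum_i w i) ->
  forall i, v i = ereal_inf (V i).
Proof.
move=> VN infV vmin i.
have : forall j, exists u, V j u /\ u < +oo.
  move=> j; have := infV j; rewrite -ltey => /ereal_inf_lt[u Vu uy]; by exists u.
move=> /choice[u uP].
have uy : \sum_j u j < +oo by apply: lte_sum_pinfty => j _; case: (uP j).
have vy := le_lt_trans (vmin u (fun j => (uP j).1)) uy.
have vN j : v j != -oo by exact: VN (Vv j).
have vfin j : v j \is a fin_num.
  rewrite fin_numE vN /=; apply: contraTneq vy => vj.
  rewrite -leNgt leye_eq esum_eqy //; by apply/existsP; exists j; rewrite vj eqxx.
apply/eqP; rewrite eq_le ereal_inf_lbound // andbT leNgt.
apply/negP => /ereal_inf_lt[w Vw wv].
pose w' j := if j == i then w else v j.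
have /vmin : forall j, V j (w' j) by move=> j; rewrite /w'; case: eqP => [->|].
rewrite (bigD1 i) //= [leRHS](bigD1 i) //= {1}/w' eqxx.
rewrite [X in _ <= _ + X](eq_bigr v); last by move=> j /negPf ji; rewrite /w' ji.
rewrite leNgt lteD2rE ?wv //; apply/sum_fin_numP => j _ _; exact: vfin.
Qed.

End ExtendedSums.

Lemma maximal_sum (R : realType) (I : finType) (V : I -> set (\bar R))
    (v : I -> \bar R) : (forall i, V i (v i)) ->
  (forall i w, V i w -> w != +oo%E) ->
  (forall i, ereal_sup (V i) != -oo%E) ->
  (forall w : I -> \bar R, (forall i, V i (w i)) ->
     (\sum_i w i <= \sum_i v i)%E) ->
  forall i, v i = ereal_sup (V i).
Proof.
move=> Vv VN supV vmax i; apply: oppe_inj; rewrite -ereal_infN.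
apply: (@minimal_sum R I (fun i => -%E @` V i)%classic (fun i => - v i)%E) => //.
- by move=> j; exists (v j).
- move=> j _ [w Vw <-]; rewrite eqe_oppLR; exact: VN Vw.
- by move=> j; rewrite ereal_infN eqe_oppLR.
move=> w wP; have : forall j, V j (- w j)%E.
  by move=> j; have [u Vu <-] := wP j; rewrite oppeK.
(* Negation passes through a sum of extended reals only if opposite infinities do not meet, hence
   the condition on [f]. *)
move=> Vw; have fN (f : I -> \bar R) : (forall j, f j != +oo%E) ->
    (\sum_j - f j)%E = (- \sum_j f j)%E.
  move=> fy; apply: sumeN => j l _ _; apply: ltpinfty_adde_def;
  by rewrite inE ltey; apply: fy.
have -> : (\sum_j w j)%E = (\sum_j - - w j)%E by apply: eq_bigr => j _; rewrite oppeK.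
rewrite (fN v) ?(fN (fun j => - w j)%E) ?leeN2; first exact: vmax.
- by move=> j; apply: VN (Vw j).
- by move=> j; apply: VN (Vv j).
Qed.

(** * Counting lemmas *)

Lemma card_half (V : finType) (h : pred V) (phi : V -> V) : injective phi ->
  (forall v, h v -> ~~ h (phi v)) -> (2 * #|h| <= #|V|)%N.
Proof.
move=> inj flip; rewrite mul2n -addnn -[leqRHS](cardC h) leq_add2l -(card_image inj h).
apply: subset_leq_card; apply/fintype.subsetP => _ /fintype.imageP[v hv ->].
exact: flip.
Qed.

(** The fibres of [w i] over [h] cover [S], and [h] contains at most half of the values. This is the
    inductive step of the count, where [a] and [c] are powers of [#|V|] and 2; the product form
    avoids division. *)
Lemma card_fibers (I V : finType) (S : {set {ffun I -> V}}) (i : I) (h : pred V)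
    (a c : nat) : (2 * #|h| <= #|V|)%N ->
  (forall w : {ffun I -> V}, w \in S -> h (w i)) ->
  (forall v, h v -> #|[set w : {ffun I -> V} in S | w i == v]| * c <= a)%N ->
  (#|S| * (2 * c) <= #|V| * a)%N.
Proof.
move=> half Sh fib; rewrite mulnCA; apply: leq_trans (leq_mul half (leqnn a)).
rewrite -mulnA leq_mul2l /=.
have -> : #|S| = (\sum_(v | h v) #|[set w : {ffun I -> V} in S | w i == v]|)%N.
  rewrite -sum1_card (partition_big (fun w : {ffun I -> V} => w i) h) //.
  by apply: eq_bigr => v _; rewrite -sum1dep_card.
rewrite big_distrl /= -sum_nat_const; exact: leq_sum.
Qed.

(** * Renaming of items and optima of instances *)

Section Instances.
Variables (R : realType) (B : problem R).
Implicit Types (x y z : item B) (G H : seq (item B)) (f g : name B -> name B).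

Definition alike x y : Prop := exists2 f, bijective f & y = rename f x.

Lemma rename_K f g : bijective f -> cancel f g -> cancel (rename f) (@rename _ B g).
Proof.
move=> bf fK x; have bg : bijective g by apply: bij_can_bij fK.
rewrite -(rename_comp x bg bf) -[RHS]rename_id; apply: rename_ext => [||a _].
- exact: bij_comp.
- by exists id.
- exact: fK.
Qed.

Lemma alike_refl x : alike x x.
Proof. by exists id; [exists id | rewrite rename_id]. Qed.

Lemma alike_sym x y : alike x y -> alike y x.
Proof.
move=> [f bf ->]; have [g fK gK] := bf.
by exists g; [exists f | rewrite (rename_K bf fK)].
Qed.

Lemma alike_trans x y z : alike x y -> alike y z -> alike x z.
Proof.
by move=> [f bf ->] [g bg ->]; exists (g \o f); [exact: bij_comp | rewrite rename_comp].
Qed.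

(** Only the action of the renaming on the names of [x] matters, and it sends them to names of [y].
    So it can be replaced by one that moves nothing outside [S]. *)
Lemma alike_ext (S : seq (name B)) x y : uniq S -> alike x y ->
  {subset names_of x <= S} -> {subset names_of y <= S} ->
  exists s : 'S_(size S), y = rename (ext s) x.
Proof.
move=> uS [f bf ->] xS yS.
have [|s sf] := ext_extend uS (bij_inj bf) xS.
  by move=> a; rewrite -names_rename //; exact: yS.
exists s; apply: rename_ext => //; first exact: ext_bij.
by move=> a ax; rewrite sf.
Qed.

Definition same_pattern G H : Prop :=
  exists2 f, bijective f & perm_eq H (map (rename f) G).

Lemma same_pattern_sym G H : same_pattern G H -> same_pattern H G.
Proof.
move=> [f bf GH]; have [g fK gK] := bf; exists g; first by exists f.
rewrite perm_sym; apply: perm_trans (perm_map _ GH) _.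
by rewrite -map_comp (eq_map (rename_K bf fK)) map_id.
Qed.

Lemma same_pattern_trans G H K :
  same_pattern G H -> same_pattern H K -> same_pattern G K.
Proof.
move=> [f bf GH] [g bg HK]; exists (g \o f); first exact: bij_comp.
apply: perm_trans HK _; apply: perm_trans (perm_map _ GH) _.
by rewrite -map_comp (eq_map (g := rename (g \o f))) // => x; rewrite /= rename_comp.
Qed.

Lemma same_pattern_alike G H x : same_pattern G H -> x \in G ->
  exists2 y, y \in H & alike x y.
Proof.
move=> [f bf GH] xG; exists (rename f x); last by exists f.
by rewrite (perm_mem GH) map_f.
Qed.

Lemma outcomes_first_sub G x b v : outcomes_first G x b v -> outcomes G v.
Proof. by move=> [D DG ->]; exists ((x, b) :: D). Qed.

(** If [OPT G] were the infeasible value, so would be the best value over any subset of the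
    outcomes, and every first decision would be optimal. *)
Lemma feasible_OPT G x b : ~ decision_optimal G x b ->
  OPT G != (if minimization B then +oo else -oo)%E.
Proof.
rewrite /decision_optimal /OPT /best => nopt; apply/eqP => inf; apply: nopt.
case: (minimization B) inf => inf; rewrite inf; apply/eqP.
  rewrite -leye_eq -inf; apply: le_ereal_inf_tmp => v /outcomes_first_sub.
  exact: ereal_inf_lbound.
rewrite -leeNy_eq -inf; apply: ge_ereal_sup => v /outcomes_first_sub.
exact: ereal_sup_ubound.
Qed.

Lemma decision_optimal_obj G x b (D : seq (item B * bool)) :
  perm_eq (x :: unzip1 D) G -> obj ((x, b) :: D) = OPT G ->
  decision_optimal G x b.
Proof.
move=> DG Dopt; have Vopt : outcomes_first G x b (OPT G) by exists D.
rewrite /decision_optimal; move: Vopt; rewrite /OPT /best.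
case: (minimization B) => Vopt; apply/eqP; rewrite eq_le.
  rewrite ereal_inf_lbound //=; apply: le_ereal_inf_tmp => v /outcomes_first_sub.
  exact: ereal_inf_lbound.
rewrite [X in _ && X]ereal_sup_ubound // andbT.
apply: ge_ereal_sup => v /outcomes_first_sub; exact: ereal_sup_ubound.
Qed.

Section OptimalParts.
Variables (I : finType) (H : I -> seq (item B)) (D : I -> seq (item B * bool)).
Hypothesis feasible : forall i,
  OPT (H i) != (if minimization B then +oo else -oo)%E.
Hypothesis sum_parts : forall E : I -> seq (item B * bool),
  (forall i, perm_eq (unzip1 (E i)) (H i)) ->
  obj (flatten [seq E i | i <- enum I]) = (\sum_i obj (E i))%E.
Hypothesis parts : forall i, perm_eq (unzip1 (D i)) (H i).

Lemma perm_flatten_unzip1 (E : I -> seq (item B * bool)) :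
  (forall i, perm_eq (unzip1 (E i)) (H i)) ->
  perm_eq (unzip1 (flatten [seq E i | i <- enum I]))
          (flatten [seq H i | i <- enum I]).
Proof.
move=> EH; rewrite /unzip1 map_flatten -map_comp.
by elim: (enum I) => //= i s IH; apply: perm_cat (EH i) IH.
Qed.

(** Outcomes of the parts can be combined freely into an outcome of the whole, so the values
    [obj (D i)] optimize the sum over all choices, and the exchange argument applies to each
    part. *)
Lemma optimal_parts :
  obj (flatten [seq D i | i <- enum I]) = OPT (flatten [seq H i | i <- enum I]) ->
  forall i, obj (D i) = OPT (H i).
Proof.
rewrite (sum_parts parts).
pose X := flatten [seq H i | i <- enum I].
have sumV (w : I -> \bar R) : (forall i, outcomes (H i) (w i)) ->
    outcomes X (\sum_i w i)%E.
  move=> wV; have /choice[E EP] : forall i, exists E,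
      perm_eq (unzip1 E) (H i) /\ w i = obj E.
    by move=> i; have [E EH wE] := wV i; exists E.
  exists (flatten [seq E i | i <- enum I]).
    by apply: perm_flatten_unzip1 => i; case: (EP i).
  rewrite sum_parts => [|i]; last by case: (EP i).
  by apply: eq_bigr => i _; case: (EP i).
have VD i : outcomes (H i) (obj (D i)) by exists (D i).
move: feasible sumV; rewrite /OPT /best -/X.
have := @obj_infeasible _ B.
case: (minimization B) => infeas feas sumV opt.
  apply: minimal_sum => //.
    by move=> i _ [E _ ->]; apply/eqP.
  by move=> w wV; rewrite opt; apply: ereal_inf_lbound; exact: sumV.
apply: maximal_sum => //.
  by move=> i _ [E _ ->]; apply/eqP.
by move=> w wV; rewrite opt; apply: ereal_sup_ubound; exact: sumV.
Qed.

End OptimalParts.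
End Instances.

(** * Executions and their dependence on the tape *)

Section Executions.
Variables (R : realType) (B : problem R) (A : algorithm B) (T : tiebreaker B).
Implicit Types (s xs : seq (item B)) (ds : seq bool) (tape : nat -> bool).

Lemma reads_le tape xs ds p q : reads A tape xs ds p q -> (p <= q)%N.
Proof. by case. Qed.

Lemma reads_fun tape xs ds p q q' :
  reads A tape xs ds p q -> reads A tape xs ds p q' -> q = q'.
Proof.
move=> [pq more_q stop_q] [pq' more_q' stop_q'].
case: (ltngtP q q') => // qq'.
  by move: stop_q; rewrite more_q' // pq.
by move: stop_q'; rewrite more_q // pq'.
Qed.

Lemma steps_le tape s xs ds p D q :
  steps A T tape s xs ds p D q -> (p <= q)%N.
Proof.
by elim=> // {}s {}xs {}ds {}p x p' {}D {}q _ _ /reads_le pp' _; exact: leq_trans.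
Qed.

Lemma mkseq_eq_below (tape tape' : nat -> bool) k l : (l <= k)%N ->
  mkseq tape k = mkseq tape' k -> mkseq tape l = mkseq tape' l.
Proof. by move=> lk /(congr1 (take l)); rewrite -!map_take !take_iota (minn_idPl lk). Qed.

Lemma reads_local (tape tape' : nat -> bool) k xs ds p q : (q <= k)%N ->
  mkseq tape k = mkseq tape' k -> reads A tape xs ds p q -> reads A tape' xs ds p q.
Proof.
move=> qk eqt [pq more_q stop_q]; split=> //.
  move=> l /andP[pl lq]; rewrite -(mkseq_eq_below _ eqt) ?more_q ?pl //.
  exact: leq_trans (ltnW lq) qk.
by rewrite -(mkseq_eq_below _ eqt).
Qed.

(** The read position never decreases, so all prefixes consulted along the execution have length at
    most [q], hence at most [k]. *)
Lemma steps_local (tape tape' : nat -> bool) k s xs ds p D q : (q <= k)%N ->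
  mkseq tape k = mkseq tape' k ->
  steps A T tape s xs ds p D q -> steps A T tape' s xs ds p D q.
Proof.
move=> qk eqt st; elim: st qk => [{}xs {}ds {}p _|]; first exact: steps_end.
move=> {}s {}xs {}ds {}p x p' {}D {}q s0 xE rd st IH qk.
have p'k := leq_trans (steps_le st) qk.
have pk := leq_trans (reads_le rd) p'k.
apply: (steps_next (x := x) (p' := p')) => //.
- by rewrite -(mkseq_eq_below pk eqt).
- exact: reads_local p'k eqt rd.
- by rewrite -(mkseq_eq_below p'k eqt); exact: IH.
Qed.

Lemma run_local (tape tape' : nat -> bool) k X D q : (q <= k)%N ->
  mkseq tape k = mkseq tape' k -> run A T tape X D q -> run A T tape' X D q.
Proof.
move=> qk eqt [p rd st]; exists p; last exact: steps_local qk eqt st.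
exact: reads_local (leq_trans (steps_le st) qk) eqt rd.
Qed.

Lemma steps_inv tape s xs ds p D q : s != [::] ->
  steps A T tape s xs ds p D q ->
  let x := T xs ds (mkseq tape p)
             (top_items (priority A xs ds (mkseq tape p)) s) in
  exists2 p', reads A tape (rcons xs x) ds p p' &
    steps A T tape (rem x s) (rcons xs x)
      (rcons ds (decide A (rcons xs x) ds (mkseq tape p'))) p' D q.
Proof.
move=> s0 st x; case: st s0 @x => // {}s {}xs {}ds {}p y p' {}D {}q _ yE rd st _.
by rewrite -yE; exists p'.
Qed.

Lemma top_items_nil (P : item B -> R) s : s != [::] -> top_items P s != [::].
Proof. by move=> /(has_maximal P); rewrite has_filter. Qed.

Lemma steps_outcome tape s xs ds p D q : is_tiebreaker T ->
  size xs = size ds -> steps A T tape s xs ds p D q ->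
  exists2 D', D = zip xs ds ++ D' & perm_eq (unzip1 D') s.
Proof.
move=> tieT sz st; elim: st sz => [{}xs {}ds {}p _|].
  by exists [::]; rewrite ?cats0.
move=> {}s {}xs {}ds {}p x p' {}D {}q s0 xE rd st IH sz.
have [|D' -> D's] := IH; first by rewrite !size_rcons sz.
exists ((x, decide A (rcons xs x) ds (mkseq tape p')) :: D').
  by rewrite zip_rcons // cat_rcons.
have xs' : x \in s.
  have := tieT xs ds (mkseq tape p) _ (top_items_nil (priority A xs ds (mkseq tape p)) s0).
  by rewrite -xE mem_filter => /andP[].
by rewrite perm_sym (perm_trans (perm_to_rem xs')) // perm_cons perm_sym.
Qed.

Lemma run_outcome tape X D q : is_tiebreaker T -> run A T tape X D q ->
  perm_eq (unzip1 D) X.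
Proof. by move=> tieT [p _ st]; have [|D' ->] := steps_outcome tieT _ st. Qed.

End Executions.

(** * Consequences of the conditions on gadgets *)

Section Gadgets.
Variables (R : realType) (B : problem R) (k : nat) (C : pattern_pairs B k).
Variables (m : nat) (N : 'I_m -> set (name B)) (U : 'I_m -> set (item B)).
Variable ident : item B -> 'I_k.
Hypothesis U_sub : forall i, subuniverse C (N i) (U i).
Hypothesis U_first : first_item C U ident.
Hypothesis U_decision : distinguishing_decision C U ident.
Hypothesis U_disjoint : disjoint_copies N U.

Definition pat (b : bool) (j : 'I_k) : seq (item B) :=
  if b then pat_a C j else pat_r C j.

Lemma pat_in_collection b j : in_collection C (pat b j).
Proof. by exists j; case: b; [left | right]. Qed.

Lemma pat_neq0 b j : pat b j != [::].
Proof. by case: b; [case: (pat_aP C j) | case: (pat_rP C j)]. Qed.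

Lemma size_pat b j : (size (pat b j) <= max_pattern_size C)%N.
Proof.
apply: leq_trans (leq_bigmax j).
by case: b; rewrite leq_max leqnn ?orbT.
Qed.

Lemma subuniverse_inj i i' x : U i x -> U i' x -> i = i'.
Proof.
move=> Ux U'x; apply/eqP; case: (boolP (i == i')) => // ii'.
have [_ /(_ _ _ ii') U0 _] := U_disjoint.
by have : (U i `&` U i')%classic x by []; rewrite U0.
Qed.

Lemma names_inj i i' a : N i a -> N i' a -> i = i'.
Proof.
move=> Na N'a; apply/eqP; case: (boolP (i == i')) => // ii'.
have [/(_ _ _ ii') N0 _ _] := U_disjoint.
by have : (N i `&` N i')%classic a by []; rewrite N0.
Qed.

(** This makes artificial priority functions available to the first item and distinguishing decision
    conditions. *)
Lemma alike_fresh_priority i (P : item B -> R) :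
  (forall x y, alike x y -> P x = P y) -> fresh_priority U i P.
Proof.
move=> PE; exists [::] => // x y _ _ [f [bf _ ->]].
by apply: PE; exists f.
Qed.

(** The names of [x] and [y] lie in [N i], which is disjoint from the names seen so far. A renaming
    that takes [x] to [y] can therefore be chosen to fix every seen name. *)
Lemma oblivious_alike (seen : seq (item B)) (P : item B -> R) i x y :
  (forall z, z \in seen -> exists2 i', i' != i & U i' z) ->
  oblivious (union_universe U) seen P ->
  U i x -> U i y -> alike x y -> P x = P y.
Proof.
move=> seenP obl Ux Uy xy.
pose S := undup (names_of x ++ names_of y).
have SN a : a \in S -> N i a.
  rewrite mem_undup mem_cat; have [names _ _] := U_sub i.
  by case/orP; apply: names.
have uS : uniq S by exact: undup_uniq.
have [||s yE] := alike_ext uS xy.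
- by move=> a ax; rewrite mem_undup mem_cat ax.
- by move=> a ay; rewrite mem_undup mem_cat ay orbT.
apply: obl; [by exists i | by exists i |].
exists (ext s); split=> //; first exact: ext_bij.
move=> z a /seenP[i' i'i U'z] az; apply: ext_out => //.
apply/negP => /SN Na; have [names _ _] := U_sub i'.
by move: i'i; rewrite (names_inj Na (names _ _ U'z az)) eqxx.
Qed.

Lemma first_decision i (P : item B -> R) H x : fresh_priority U i P ->
  gadget_in C (U i) H -> x \in top_items P H ->
  exists2 b, copy_in (U i) (pat b (ident x)) H &
    decision_optimal H x b /\ ~ decision_optimal H x (~~ b).
Proof.
move=> fP gH xH; have [decT decF] := U_decision fP xH.
have [[cH|cH] _ _] := U_first fP gH xH; [exists true | exists false] => //.
  exact: decT.
exact: decF.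
Qed.

Lemma first_pair i (P : item B -> R) H x : fresh_priority U i P ->
  gadget_in C (U i) H -> x \in top_items P H ->
  forall b, exists2 H', copy_in (U i) (pat b (ident x)) H' & x \in top_items P H'.
Proof. by move=> fP gH xH; have [_ ? ?] := U_first fP gH xH; case. Qed.

Lemma top_items_const c (H : seq (item B)) : top_items (fun=> c : R) H = H.
Proof. by apply/all_filterP/allP => x _; apply/allP => y _ /=. Qed.

(** Under a constant priority every item of a gadget has top priority, so any item of any gadget can
    serve as the first item and identifies a pair. *)
Lemma reference_pair (i0 : 'I_m) : (0 < k)%N -> exists x0 (G : bool -> seq (item B)),
  forall b, copy_in (U i0) (pat b (ident x0)) (G b) /\ x0 \in G b.
Proof.
move=> k0; have [_ _ /(_ _ (pat_in_collection true (Ordinal k0)))[H cH]] := U_sub i0.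
have H0 : H != [::].
  have := pat_neq0 true (Ordinal k0); have [[f bf /perm_size]] := cH.
  by rewrite size_map -!size_eq0 => ->.
case: H H0 cH => // x0 H _ cH; exists x0.
have /choice[G GP] : forall b, exists H',
    copy_in (U i0) (pat b (ident x0)) H' /\ x0 \in H'.
  move=> b; have [|||H' cH' xH'] := @first_pair i0 (fun=> 0%R) (x0 :: H) x0 _ _ _ b.
  - by apply: alike_fresh_priority.
  - by exists (pat true (Ordinal k0)) => //; exact: pat_in_collection.
  - by rewrite top_items_const mem_head.
  by exists H'; rewrite top_items_const in xH'.
by exists G.
Qed.

(** * A reference pair of gadgets with a common item *)

Variables (i0 : 'I_m) (x0 : item B) (G : bool -> seq (item B)).
Hypothesis GP : forall b, copy_in (U i0) (pat b (ident x0)) (G b).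
Hypothesis x0G : forall b, x0 \in G b.

(** Otherwise [G true] would be a copy of both patterns, and accepting [x0] would be both optimal
    and not optimal for it. *)
Lemma patterns_differ b : ~ same_pattern (pat b (ident x0)) (pat (~~ b) (ident x0)).
Proof.
move=> same_b.
have same : same_pattern (pat false (ident x0)) (pat true (ident x0)).
  by case: b same_b => // /same_pattern_sym.
have fP : fresh_priority U i0 (fun=> 0%R : R) by apply: alike_fresh_priority.
have [|decT decF] := U_decision (H := G true) (x := x0) fP.
  by rewrite top_items_const.
have [opt _] := decT (GP true); have [|_ nopt] := decF; last exact: nopt.
by split; [exact: same_pattern_trans same (GP true).1 | exact: (GP true).2].
Qed.

(* Otherwise the priority function that ranks the items alike [x] first and
   those alike [x0] second could select [x0] in [G b'] but in no copy of
   [G b]. *)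
Lemma reference_alike b b' x : x \in G b -> exists2 y, y \in G b' & alike x y.
Proof.
move=> xG; apply: contrapT => noy.
have ny y : y \in G b' -> ~ alike x y by move=> yG xy; apply: noy; exists y.
pose P y : R := if `[< alike x y >] then 2%R else if `[< alike x0 y >] then 1%R else 0%R.
have fP : fresh_priority U i0 P.
  apply: alike_fresh_priority => y z yz; have zy := alike_sym yz.
  have E w : `[< alike w y >] = `[< alike w z >].
    by apply: asbool_equiv_eq; split=> wy; exact: alike_trans wy _.
  by rewrite /P !E.
have Px0 : P x0 = 1%R.
  rewrite /P asboolF; last exact: ny (x0G b').
  by rewrite asboolT //; exact: alike_refl.
have x0top : x0 \in top_items P (G b').
  rewrite mem_filter x0G andbT; apply/allP => y yG; rewrite Px0 /P asboolF; last exact: ny.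
  by case: ifP; rewrite ?ler01.
have [|H' [sH' _]] := @first_pair _ _ _ _ fP _ x0top b.
  by exists (pat b' (ident x0)); [exact: pat_in_collection | exact: GP].
rewrite mem_filter => /andP[/allP x0max _].
have [y yH' xy] :=
  same_pattern_alike (same_pattern_trans (same_pattern_sym (GP b).1) sH') xG.
have := x0max y yH'; rewrite Px0 /P asboolT //.
by rewrite leNgt ltr1n.
Qed.

Definition gadget_names : seq (name B) :=
  undup (flatten [seq names_of x | x <- G true ++ G false]).

Lemma gadget_names_uniq : uniq gadget_names. Proof. exact: undup_uniq. Qed.

Lemma names_of_gadget b x : x \in G b -> {subset names_of x <= gadget_names}.
Proof.
move=> xG a ax; rewrite mem_undup; apply/flatten_mapP; exists x => //.
by rewrite mem_cat; case: b xG => ->; rewrite ?orbT.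
Qed.

Lemma gadget_names_sub a : a \in gadget_names -> N i0 a.
Proof.
rewrite mem_undup => /flatten_mapP[x xG ax]; have [names _ _] := U_sub i0.
apply: names ax; move: xG; rewrite mem_cat.
by case/orP=> xG; [apply: (GP true).2 | apply: (GP false).2].
Qed.

(** * Variants of the reference gadgets in all subuniverses *)

Variable g : 'I_m -> name B -> name B.
Hypothesis g_bij : forall i, bijective (g i).
Hypothesis U_g : forall i, U i = (rename (g i) @` U i0)%classic.

(** A pattern together with a permutation of the names. Different variants may give the same gadget;
    counting variants instead of gadgets keeps the pairing of the two patterns a plain injection. *)
Definition variant : finType := (bool * 'S_(size gadget_names))%type.

Definition variant_map i (s : 'S_(size gadget_names)) : name B -> name B :=
  g i \o ext s.

Definition gadget i (v : variant) : seq (item B) :=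
  map (rename (variant_map i v.2)) (G v.1).

Lemma variant_map_bij i s : bijective (variant_map i s).
Proof. by apply: bij_comp (g_bij i) _; apply: ext_bij; exact: gadget_names_uniq. Qed.

(** Permuting [gadget_names] keeps all names in [N i0], so closure of the subuniverse keeps the item
    in [U i0]; then [g i] carries it to [U i]. *)
Lemma gadget_item i b s x : x \in G b -> U i (rename (variant_map i s) x).
Proof.
move=> xG; have sb : bijective (ext s) by apply: ext_bij; exact: gadget_names_uniq.
rewrite /variant_map rename_comp // U_g; exists (rename (ext s) x) => //.
have [[f bf Gf] _] := GP b.
have [_ closed _] := U_sub i0.
have := xG; rewrite (perm_mem Gf) => /mapP[y yp ->].
rewrite -rename_comp //; apply: (closed (pat b (ident x0))) yp.
- exact: pat_in_collection.
- exact: bij_comp.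
move=> z a zp; rewrite rename_comp // names_rename // => /mapP[c cz ->].
apply: gadget_names_sub; apply: ext_mem; first exact: gadget_names_uniq.
by apply: (names_of_gadget (b := b)) cz; rewrite (perm_mem Gf) map_f.
Qed.

Lemma gadget_sub i v x : x \in gadget i v -> U i x.
Proof. by move=> /mapP[y yG ->]; exact: gadget_item yG. Qed.

Lemma gadget_copy i v : copy_in (U i) (pat v.1 (ident x0)) (gadget i v).
Proof.
split; last exact: gadget_sub.
apply: same_pattern_trans (GP v.1).1 _.
by exists (variant_map i v.2); first exact: variant_map_bij.
Qed.

Lemma gadget_in_gadget i v : gadget_in C (U i) (gadget i v).
Proof. by exists (pat v.1 (ident x0)); [exact: pat_in_collection | exact: gadget_copy]. Qed.

Lemma gadget_neq0 i v : gadget i v != [::].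
Proof. by rewrite /gadget -size_eq0 size_map; case: (G v.1) (x0G v.1). Qed.

Lemma size_gadget i v : (size (gadget i v) <= max_pattern_size C)%N.
Proof.
have [[f _ /perm_size ->] _] := gadget_copy i v.
by rewrite size_map size_pat.
Qed.

Lemma variant_map_alike i s x : alike x (rename (variant_map i s) x).
Proof. by exists (variant_map i s); first exact: variant_map_bij. Qed.

Lemma gadget_alike i v v' x : x \in gadget i v ->
  exists2 y, y \in gadget i v' & alike x y.
Proof.
move=> /mapP[e eG ->]; have [e' e'G ee'] := reference_alike v'.1 eG.
exists (rename (variant_map i v'.2) e'); first exact: map_f.
apply: alike_trans (variant_map_alike i v'.2 e').
by apply: alike_trans ee'; apply: alike_sym; exact: variant_map_alike.
Qed.

Lemma gadget_alike_reference i v x : x \in gadget i v ->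
  exists2 y, y \in G true & alike x y.
Proof.
move=> /mapP[e eG ->]; have [y yG ey] := reference_alike true eG; exists y => //.
by apply: alike_trans ey; apply: alike_sym; exact: variant_map_alike.
Qed.

(* Composing with a permutation that exchanges the first [Q]-items of the two
   patterns matches the copies of one pattern with those of the other. *)
Lemma gadget_pairing i (Q : pred (item B)) :
  (forall x y, U i x -> U i y -> alike x y -> Q x = Q y) ->
  (forall v v' x y, x \in gadget i v -> y \in gadget i v' -> Q x -> Q y -> alike x y) ->
  exists2 phi : variant -> variant, injective phi &
    forall v, (phi v).1 = ~~ v.1 /\ forall d,
      head d [seq x <- gadget i (phi v) | Q x] = head d [seq x <- gadget i v | Q x].
Proof.
move=> Q_alike alike_Q.
(* As [Q] is constant on alike items of [U i], its value at one variant of [e] decides it for all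
   variants. *)
pose Q0 e := Q (rename (variant_map i 1%g) e).
have QE b s : [seq x <- map (rename (variant_map i s)) (G b) | Q x]
    = map (rename (variant_map i s)) [seq e <- G b | Q0 e].
  rewrite filter_map; congr map; apply: eq_in_filter => e eG /=.
  apply: Q_alike; [exact: gadget_item eG | exact: gadget_item eG |].
  apply: alike_trans (variant_map_alike i 1%g e).
  by apply: alike_sym; exact: variant_map_alike.
have Q0_alike b b' e e' : e \in G b -> e' \in G b' -> Q0 e -> Q0 e' -> alike e e'.
  move=> eG eG' Qe Qe'; apply: alike_trans (variant_map_alike i 1%g e) _.
  apply: alike_trans (alike_sym (variant_map_alike i 1%g e')).
  by apply: (alike_Q (b, 1%g) (b', 1%g)) => //; exact: map_f.
have Q0_nil b b' : [seq e <- G b | Q0 e] = [::] -> [seq e <- G b' | Q0 e] = [::].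
  move=> nilb; apply/eqP; rewrite -[_ == _]negbK -has_filter; apply/hasPn => e eG.
  have [e' e'G ee'] := reference_alike b eG.
  have : e' \notin [seq e <- G b | Q0 e] by rewrite nilb.
  rewrite mem_filter e'G andbT; congr (~~ _).
  apply: Q_alike; [exact: gadget_item e'G | exact: gadget_item eG |].
  apply: alike_trans (variant_map_alike i 1%g e).
  apply: alike_trans (alike_sym ee').
  by apply: alike_sym; exact: variant_map_alike.
(* If there are no [Q]-items, both heads are the default and any permutation will do. *)
have /choice[t tP] : forall b, exists t : 'S_(size gadget_names), forall s d,
    head d (map (rename (variant_map i (t * s)%g)) [seq e <- G (~~ b) | Q0 e]) =
    head d (map (rename (variant_map i s)) [seq e <- G b | Q0 e]).
  move=> b; case Eb: [seq e <- G b | Q0 e] => [|e l].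
    by exists 1%g => s d; rewrite (Q0_nil _ _ Eb).
  case Eb': [seq e <- G (~~ b) | Q0 e] => [|e' l'].
    by rewrite (Q0_nil _ _ Eb') in Eb.
  have : e \in [seq e <- G b | Q0 e] by rewrite Eb mem_head.
  rewrite mem_filter => /andP[Qe eG].
  have : e' \in [seq e <- G (~~ b) | Q0 e] by rewrite Eb' mem_head.
  rewrite mem_filter => /andP[Qe' e'G].
  have [||t tE] := alike_ext gadget_names_uniq (Q0_alike _ _ _ _ e'G eG Qe' Qe).
  - exact: names_of_gadget e'G.
  - exact: names_of_gadget eG.
  exists t => s d /=; rewrite tE -rename_comp; first last.
  - by apply: ext_bij; exact: gadget_names_uniq.
  - exact: variant_map_bij.
  apply: rename_ext; first exact: variant_map_bij.
    apply: bij_comp (variant_map_bij _ _) _.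
    by apply: ext_bij; exact: gadget_names_uniq.
  by move=> a _; rewrite /variant_map /= extM //; exact: gadget_names_uniq.
exists (fun v => (~~ v.1, t v.1 * v.2)%g).
  move=> [b s] [b' s'] /= [/negb_inj <-] /mulgI -> //.
by move=> [b s]; split=> //= d; rewrite /gadget /= !QE tP.
Qed.

(** A decision optimal for both gadgets would make them copies of the same pattern of the pair
    [ident x], contradicting [patterns_differ]. *)
Lemma opposite_decisions i (P : item B -> R) v v' x d : fresh_priority U i P ->
  v'.1 = ~~ v.1 -> x \in top_items P (gadget i v) -> x \in top_items P (gadget i v') ->
  decision_optimal (gadget i v) x d -> ~ decision_optimal (gadget i v') x d.
Proof.
move=> fP vv' xv xv' opt opt'.
have [b [cb _] [optb noptb]] := first_decision fP (gadget_in_gadget i v) xv.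
have [b' [cb' _] [optb' noptb']] := first_decision fP (gadget_in_gadget i v') xv'.
have db : d = b by case: d b opt noptb {optb cb opt'} => [] [].
have db' : d = b' by case: d b' opt' noptb' {optb' cb' opt db} => [] [].
move: cb cb'; rewrite -db -db' => cb cb'.
apply: (@patterns_differ v.1); rewrite -vv'.
apply: same_pattern_trans (gadget_copy i v).1 _.
apply: same_pattern_trans (same_pattern_sym cb) _.
by apply: same_pattern_trans cb' _; apply: same_pattern_sym (gadget_copy i v').1.
Qed.

Lemma gadget_feasible i v :
  OPT (gadget i v) != (if minimization B then +oo else -oo)%E.
Proof.
have fP : fresh_priority U i (fun=> 0%R : R) by apply: alike_fresh_priority.
case E: (gadget i v) (gadget_neq0 i v) => [|x H] // _.
have [|b _ [_ nopt]] := first_decision (x := x) fP (gadget_in_gadget i v).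
  by rewrite top_items_const E mem_head.
by rewrite -E; exact: feasible_OPT nopt.
Qed.


(** * Classes of items and the tie-breaking rule *)

Definition own i : pred (item B) := fun x => `[< U i x >].

Lemma ownP i x : reflect (U i x) (own i x). Proof. exact: asboolP. Qed.

Lemma own_gadget i v : all (own i) (gadget i v).
Proof. by apply/allP => x /gadget_sub Ux; apply/ownP. Qed.

(** Representatives of the pairs of a subuniverse and an orbit of gadget items. Repetitions are
    harmless, since a key is the first matching position. *)
Definition classes : seq ('I_m * item B) :=
  [seq (i, e) | i <- enum 'I_m, e <- G true].

Definition in_class x (c : 'I_m * item B) : bool := `[< U c.1 x /\ alike x c.2 >].

Definition class_key x : nat := find (in_class x) classes.

Lemma class_key_alike i x y : U i x -> U i y -> alike x y -> class_key x = class_key y.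
Proof.
move=> Ux Uy xy; apply: eq_find => -[i' e]; apply: asbool_equiv_eq => /=.
split=> -[U' e']; split.
- by rewrite -(subuniverse_inj Ux U').
- exact: alike_trans (alike_sym xy) e'.
- by rewrite -(subuniverse_inj Uy U').
- exact: alike_trans xy e'.
Qed.

Lemma has_class i v x : x \in gadget i v -> has (in_class x) classes.
Proof.
move=> xg; have [e eG xe] := gadget_alike_reference xg.
apply/hasP; exists (i, e); last by apply/asboolP; split=> //; exact: gadget_sub xg.
by apply/allpairsP; exists (i, e); rewrite mem_enum.
Qed.

(** Every item of a gadget lies in some class, so a common key points to a class that contains both
    items. *)
Lemma class_key_inj i v i' v' x y : x \in gadget i v -> y \in gadget i' v' ->
  class_key x = class_key y -> i = i' /\ alike x y.
Proof.
move=> xg yg xy.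
have /asboolP[Ux xe] := nth_find (i, x) (has_class xg).
have /asboolP[Uy ye] := nth_find (i, x) (has_class yg).
move: Ux xe; rewrite -/(class_key x) xy -/(class_key y) => Ux xe; split.
  by rewrite (subuniverse_inj (gadget_sub xg) Ux) (subuniverse_inj (gadget_sub yg) Uy).
exact: alike_trans xe (alike_sym ye).
Qed.

(* Ties between classes are broken by [class_key], ties within a class by the
   position in the list; the latter is what makes the names of the first item
   of a gadget uninformative. *)
Definition tie : tiebreaker B := fun _ _ _ s =>
  head x0 [seq x <- s | all (fun y => class_key x <= class_key y)%N s].

Lemma head_mem (s : seq (item B)) : s != [::] -> head x0 s \in s.
Proof. by case: s => // x s _; exact: mem_head. Qed.

Lemma tie_tiebreaker : is_tiebreaker tie.
Proof.
move=> xs ds adv s /(has_minimal class_key); rewrite has_filter => /head_mem.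
by rewrite mem_filter => /andP[].
Qed.

(** The last part describes the choice as a filter of [s] by two values, so that it can be compared
    across inputs once these values are known to agree. *)
Lemma tie_spec xs ds adv (P : item B -> R) s : s != [::] ->
  let x := tie xs ds adv (top_items P s) in
  [/\ x \in top_items P s,
      forall y, y \in s -> P y = P x -> (class_key x <= class_key y)%N
    & x = head x0 [seq y <- s | (P y == P x) && (class_key y == class_key x)]].
Proof.
move=> s0 x; set t := top_items P s.
have t0 : t != [::] by exact: top_items_nil.
have := t0 => /(has_minimal class_key); rewrite has_filter => /head_mem.
rewrite -/(tie xs ds adv t) -/x mem_filter => /andP[/allP xmin xt].
have := xt; rewrite mem_filter => /andP[/allP xmax xs'].
split; [by rewrite xs' andbT; apply/allP | move=> y ys yx |].
  by apply: xmin; rewrite mem_filter ys andbT; apply/allP => z zs; rewrite yx; exact: xmax.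
rewrite {1}/x /tie; congr head; rewrite -/t {2}/t /top_items -filter_predI.
apply: eq_in_filter => y ys /=.
apply/andP/andP => -[].
  move=> /allP ymin /allP ymax; rewrite !eq_le ymax ?xmax //.
  have yt : y \in t by rewrite mem_filter ys andbT; apply/allP.
  by rewrite leEnat ymin ?xmin.
move=> /eqP yx /eqP kyx; split; apply/allP => z.
  by rewrite kyx; exact: xmin.
by rewrite yx; exact: xmax.
Qed.

(** * Counting the profiles solved with a fixed tape *)

Section FixedTape.
Variables (A : algorithm B) (tape : nat -> bool).
Hypothesis A_oblivious : oblivious_algorithm (union_universe U) A.

Local Notation profile := {ffun 'I_m -> variant}.

Definition agree (J : {set 'I_m}) (w0 : profile) :
    {set profile} :=
  [set w : profile | [forall i, (i \notin J) ==> (w i == w0 i)]].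

Lemma agreeP (J : {set 'I_m}) (w0 w : profile) :
  reflect (forall i, i \notin J -> w i = w0 i) (w \in agree J w0).
Proof.
rewrite inE; apply: (iffP forallP) => H i; first by move=> iJ; apply/eqP/(implyP (H i)).
by apply/implyP => iJ; rewrite H.
Qed.

Lemma agree_refl (J : {set 'I_m}) (w0 : profile) : w0 \in agree J w0.
Proof. by apply/agreeP. Qed.

(** Optimality is demanded only on the unopened gadgets [J]; the factors for the opened ones have
    already been counted. *)
Definition wins (J : {set 'I_m}) (w : profile) (s xs : seq (item B))
    (ds : seq bool) (p : nat) : Prop :=
  exists D q, steps A tie tape s xs ds p D q /\
    forall i, i \in J -> obj [seq z <- D | own i z.1] = OPT (gadget i (w i)).

Definition winning (J : {set 'I_m}) (w0 : profile) (s : profile -> seq (item B)) xs ds p :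
    {set profile} :=
  [set w in agree J w0 | `[< wins J w (s w) xs ds p >]].

Lemma winningP J w0 s xs ds p (w : profile) :
  reflect (w \in agree J w0 /\ wins J w (s w) xs ds p) (w \in winning J w0 s xs ds p).
Proof.
rewrite [X in reflect _ X]finset.in_set; apply: (iffP andP) => -[wE win];
  by split=> //; apply/asboolP.
Qed.

(* [J] is the set of the subuniverses from which no item has been received; the
   gadgets in the others are those of [w0]. *)
Definition consistent_state (J : {set 'I_m}) (w0 : profile)
    (s : profile -> seq (item B)) (xs : seq (item B))
    (ds : seq bool) : Prop :=
  [/\ size xs = size ds,
      forall y, y \in xs -> exists2 i, i \notin J & U i y
    & forall w, w \in agree J w0 ->
      [/\ forall i, i \in J -> [seq x <- s w | own i x] = gadget i (w i),
          forall i, i \notin J -> [seq x <- s w | own i x] = [seq x <- s w0 | own i x]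
        & forall x, x \in s w -> exists i v, x \in gadget i v]].

Section State.
Variables (J : {set 'I_m}) (w0 : profile).
Variables (s : profile -> seq (item B)).
Variables (xs : seq (item B)) (ds : seq bool) (p : nat).
Hypothesis state : consistent_state J w0 s xs ds.
Hypothesis s_neq0 : forall w, w \in agree J w0 -> s w != [::].

Let P := priority A xs ds (mkseq tape p).
Let next w := tie xs ds (mkseq tape p) (top_items P (s w)).

Lemma seen_fresh i : i \in J -> forall z, z \in xs -> exists2 i', i' != i & U i' z.
Proof.
move=> iJ z; case: state => _ seen _ /seen[i' i'J Uz]; exists i' => //.
by apply: contraNneq i'J => ->.
Qed.

Lemma priority_fresh i : i \in J -> fresh_priority U i P.
Proof. by move=> iJ; exists xs; [exact: seen_fresh | exact: A_oblivious]. Qed.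

Lemma priority_alike i x y : i \in J -> U i x -> U i y -> alike x y -> P x = P y.
Proof. by move=> iJ; apply: oblivious_alike (seen_fresh iJ) _; exact: A_oblivious. Qed.

(** What remains of an opened gadget is the same for all profiles, and an item of an unopened one
    has an alike counterpart, with equal priority and key, in every variant. *)
Lemma same_values w w' y : w \in agree J w0 -> w' \in agree J w0 -> y \in s w ->
  exists2 y', y' \in s w' & P y' = P y /\ class_key y' = class_key y.
Proof.
move=> wE w'E ys; have [_ _ st] := state.
have [fresh seen items] := st w wE; have [fresh' seen' _] := st w' w'E.
have [i [v yg]] := items y ys; have Uy := gadget_sub yg.
have yo : y \in [seq x <- s w | own i x] by rewrite mem_filter ys andbT; apply/ownP.
case: (boolP (i \in J)) => iJ; last first.
  by exists y => //; move: yo; rewrite seen // -seen' // mem_filter => /andP[].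
move: yo; rewrite fresh // => /(gadget_alike (w' i))[y' yg' yy'].
have Uy' := gadget_sub yg'; exists y'.
  by move: yg'; rewrite -fresh' // mem_filter => /andP[].
by split; [exact: priority_alike iJ Uy' Uy (alike_sym yy')
  | exact: class_key_alike Uy' Uy (alike_sym yy')].
Qed.

Lemma next_values w w' : w \in agree J w0 -> w' \in agree J w0 ->
  P (next w') = P (next w) /\ class_key (next w') = class_key (next w).
Proof.
have le_next u u' : u \in agree J w0 -> u' \in agree J w0 -> (P (next u) <= P (next u'))%R.
  move=> uE u'E; have [] := tie_spec xs ds (mkseq tape p) P (s_neq0 uE).
  rewrite mem_filter => /andP[_ /(same_values uE u'E)[y' y's [<- _]]] _ _.
  have [] := tie_spec xs ds (mkseq tape p) P (s_neq0 u'E).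
  by rewrite mem_filter => /andP[/allP/(_ _ y's)].
have P_next u u' : u \in agree J w0 -> u' \in agree J w0 -> P (next u) = P (next u').
  by move=> uE u'E; apply/eqP; rewrite eq_le !le_next.
have le_key u u' : u \in agree J w0 -> u' \in agree J w0 ->
    (class_key (next u') <= class_key (next u))%N.
  move=> uE u'E; have [] := tie_spec xs ds (mkseq tape p) P (s_neq0 uE).
  rewrite mem_filter => /andP[_ /(same_values uE u'E)[y' y's [Py' <-]]] _ _.
  have [_ keymin _] := tie_spec xs ds (mkseq tape p) P (s_neq0 u'E).
  by apply: keymin => //; rewrite Py'; exact: P_next.
move=> wE w'E; split; first exact: P_next.
by apply/eqP; rewrite eqn_leq !le_key.
Qed.

Lemma next_mem w : w \in agree J w0 -> next w \in s w.
Proof.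
move=> wE; have [] := tie_spec xs ds (mkseq tape p) P (s_neq0 wE).
by rewrite mem_filter => /andP[].
Qed.

Lemma next_owner i w : U i (next w0) -> w \in agree J w0 -> U i (next w).
Proof.
move=> Ui wE; have [_ _ st] := state; have w0E := agree_refl J w0.
have [_ _ items] := st w wE; have [_ _ items0] := st w0 w0E.
have [i1 [v1 ng]] := items _ (next_mem wE).
have [i2 [v2 ng0]] := items0 _ (next_mem w0E).
have [i12 _] := class_key_inj ng ng0 (next_values w0E wE).2.
by rewrite (subuniverse_inj Ui (gadget_sub ng0)) -i12; exact: gadget_sub ng.
Qed.

Let same_class y := (P y == P (next w0)) && (class_key y == class_key (next w0)).

(** Priority and key of the next item are common to all profiles, and the key determines the
    subuniverse. So the item depends on [w] only through what remains of [i]. *)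
Lemma next_own i : U i (next w0) -> forall w, w \in agree J w0 ->
  next w = head x0 [seq y <- [seq x <- s w | own i x] | same_class y].
Proof.
move=> Ui w wE; have [_ _ st] := state.
have [_ _ items] := st w wE; have [_ _ items0] := st w0 (agree_refl J w0).
have [_ _ nextE] := tie_spec xs ds (mkseq tape p) P (s_neq0 wE).
apply: etrans nextE _; rewrite -filter_predI; congr head; apply: eq_in_filter => y ys /=.
rewrite -/(next w) /same_class.
have [-> ->] := next_values (agree_refl J w0) wE.
case: eqP => //= _; case: eqP => //= key_y.
have [i1 [v1 yg]] := items y ys.
have [i2 [v2 ng]] := items0 _ (next_mem (agree_refl J w0)).
have [i12 _] := class_key_inj yg ng key_y.
apply/esym/ownP; rewrite (subuniverse_inj Ui (gadget_sub ng)) -i12.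
exact: gadget_sub yg.
Qed.

End State.

Lemma filter_other_own i i' x (t : seq (item B)) : i' != i -> U i x ->
  [seq y <- rem x t | own i' y] = [seq y <- t | own i' y].
Proof.
move=> i'i Ux; apply: filter_rem_false; apply/ownP => U'x.
by move: i'i; rewrite (subuniverse_inj U'x Ux) eqxx.
Qed.

Lemma wins_step (J : {set 'I_m}) (w : profile) (t xs : seq (item B)) ds p p' : t != [::] ->
  let x := tie xs ds (mkseq tape p)
             (top_items (priority A xs ds (mkseq tape p)) t) in
  reads A tape (rcons xs x) ds p p' -> wins J w t xs ds p ->
  wins J w (rem x t) (rcons xs x)
    (rcons ds (decide A (rcons xs x) ds (mkseq tape p'))) p'.
Proof.
move=> t0 x rd [D [q [st opt]]]; have [p1 rd1 st1] := steps_inv t0 st.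
by exists D, q; rewrite (reads_fun rd rd1).
Qed.

(** No earlier item belongs to [U i], so the part of the final solution in [U i] consists of [x]
    with this decision and later items; its optimality makes the decision optimal. *)
Lemma wins_first_decision (J : {set 'I_m}) i (w : profile) (t xs : seq (item B)) ds p :
  i \in J -> size xs = size ds -> (forall y, y \in xs -> ~ U i y) ->
  t != [::] -> [seq x <- t | own i x] = gadget i (w i) ->
  let x := tie xs ds (mkseq tape p)
             (top_items (priority A xs ds (mkseq tape p)) t) in
  x \in gadget i (w i) -> wins J w t xs ds p ->
  exists p', reads A tape (rcons xs x) ds p p' /\
    decision_optimal (gadget i (w i)) x (decide A (rcons xs x) ds (mkseq tape p')).
Proof.
move=> iJ sz notseen t0 tg x xg [D [q [st /(_ i iJ) opt]]].
have [p' rd st'] := steps_inv t0 st; exists p'; split=> //.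
have [|D' DE D't] := steps_outcome tie_tiebreaker _ st'.
  by rewrite !size_rcons sz.
have ox : own i x by apply/ownP; exact: gadget_sub xg.
apply: (decision_optimal_obj (D := [seq z <- D' | own i z.1])); last first.
  rewrite -opt DE zip_rcons // filter_cat filter_rcons ox.
  rewrite (_ : [seq z <- zip xs ds | own i z.1] = [::]) //.
  apply/eqP; rewrite -[_ == _]negbK -has_filter; apply/hasPn => -[y d] /= yxs.
  apply/ownP; apply: notseen; rewrite -(@unzip1_zip _ _ xs ds) ?sz //.
  exact: (map_f fst yxs).
rewrite perm_sym; apply: perm_trans (perm_to_rem xg) _; rewrite perm_cons perm_sym.
rewrite -tg -filter_rem_true // (_ : unzip1 _ = [seq y <- unzip1 D' | own i y]).
  exact: perm_filter.
by rewrite /unzip1 filter_map.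
Qed.

Lemma winning_set0 w0 s xs ds p : (#|winning finset.set0 w0 s xs ds p| <= 1)%N.
Proof.
rewrite -(cards1 w0); apply: subset_leq_card.
apply/fintype.subsetP => w; rewrite !inE => /andP[/forallP wE _].
by apply/eqP/ffunP => i; apply/eqP; have := wE i; rewrite inE.
Qed.

(** Induction on the size of the remaining input. An item of an opened gadget is common to all
    profiles and advances the state; an item of an unopened gadget splits the profiles by their
    variant there and gains a factor of 2. *)
Lemma winning_le n : forall J w0 s xs ds p, consistent_state J w0 s xs ds ->
  (forall w, w \in agree J w0 -> size (s w) <= n)%N ->
  (#|winning J w0 s xs ds p| * 2 ^ #|J| <= #|variant| ^ #|J|)%N.
Proof.
elim: n => [|n IH] J w0 s xs ds p state size_s.
(* An unopened gadget is not empty, so input remains whenever [J] is not empty. *)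
all: have [->|[j jJ]] := set_0Vmem J; first by rewrite cards0 !expn0 muln1 winning_set0.
  have [_ _ /(_ _ (agree_refl J w0))[/(_ j jJ) fj _ _]] := state.
  have := gadget_neq0 j (w0 j); rewrite -fj -has_filter.
  by have := size_s _ (agree_refl J w0); case: (s w0).
have [sz seen st] := state.
have s_neq0 w : w \in agree J w0 -> s w != [::].
  move=> wE; have [/(_ j jJ) fj _ _] := st w wE.
  by have := gadget_neq0 j (w j); rewrite -fj; case: (s w).
pose P := priority A xs ds (mkseq tape p).
pose x w := tie xs ds (mkseq tape p) (top_items P (s w)).
have x_mem w : w \in agree J w0 -> x w \in s w by exact: next_mem s_neq0 w.
have size_rem_s w : w \in agree J w0 -> (size (rem (x w) (s w)) <= n)%N.
  by move=> wE; rewrite size_rem ?x_mem // -subn1 leq_subLR add1n size_s.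
have [i [v0 xg]] : exists i v, x w0 \in gadget i v.
  by have [_ _ items] := st _ (agree_refl J w0); apply: items; apply: x_mem; exact: agree_refl.
have Ui := gadget_sub xg.
have xE w : w \in agree J w0 -> x w = _ := next_own state s_neq0 Ui (w := w).
case: (boolP (i \in J)) => iJ; last first.
  have xw0 w : w \in agree J w0 -> x w = x w0.
    move=> wE; rewrite (xE w) // [RHS](xE w0) ?agree_refl //.
    by have [_ /(_ i iJ) -> _] := st w wE.
  (* A winning profile shows where reading stops after [x w0]; the new history is then shared by all
     profiles. *)
  have [->|[w1]] := set_0Vmem (winning J w0 s xs ds p); first by rewrite cards0.
  move=> /winningP[w1E [D [q [st1 _]]]].
  have [p' rd _] := steps_inv (s_neq0 _ w1E) st1.
  rewrite -/P -/(x w1) (xw0 _ w1E) in rd.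
  pose ds' := rcons ds (decide A (rcons xs (x w0)) ds (mkseq tape p')).
  apply: leq_trans (IH J w0 (fun w => rem (x w0) (s w)) (rcons xs (x w0)) ds' p' _ _).
  + rewrite leq_mul2r; apply/orP; right; apply: subset_leq_card.
    apply/fintype.subsetP => w /winningP[wE win]; apply/winningP; split=> //.
    have := @wins_step J w _ xs ds p p' (s_neq0 _ wE).
    by rewrite /= -/P -/(x w) (xw0 _ wE); apply.
  + split; first by rewrite !size_rcons sz.
      move=> y; rewrite mem_rcons inE => /predU1P[->|]; last exact: seen.
      by exists i.
    move=> w wE; have [fresh old items] := st w wE; split.
    * move=> i1 i1J; rewrite (filter_other_own _ _ Ui) ?fresh //.
      by apply: contraNneq iJ => <-.
    * move=> i1 i1J; have [->|i1i] := eqVneq i1 i; last first.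
        by rewrite !(filter_other_own _ i1i Ui) old.
      by rewrite !filter_rem_true ?old //; apply/ownP.
    * by move=> y /mem_rem; exact: items.
  + by move=> w wE; have := size_rem_s w wE; rewrite xw0.
pose Q y := (P y == P (x w0)) && (class_key y == class_key (x w0)).
pose xv v := head x0 [seq y <- gadget i v | Q y].
have xvE w : w \in agree J w0 -> x w = xv (w i).
  by move=> wE; rewrite (xE w wE); have [/(_ i iJ) -> _ _] := st w wE.
(* As [i] is in [J], every variant [v] occurs at [i] in some profile agreeing with [w0]. *)
pose upd v : profile := [ffun i' => if i' == i then v else w0 i'].
have updE v : upd v \in agree J w0.
  by apply/agreeP => i' i'J; rewrite ffunE; case: eqP i'J iJ => // -> /negP.
have upd_i v : upd v i = v by rewrite ffunE eqxx.
have xv_gadget w : w \in agree J w0 -> x w \in gadget i (w i).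
  move=> wE; have [/(_ i iJ) <- _ _] := st w wE.
  by rewrite mem_filter x_mem // andbT; apply/ownP; exact: next_owner Ui wE.
have xv_top v' : xv v' \in top_items P (gadget i v').
  have [fresh _ _] := st _ (updE v'); have := xv_gadget _ (updE v').
  rewrite xvE // upd_i => xvg; rewrite mem_filter xvg andbT; apply/allP => y.
  rewrite -{1}(upd_i v') -fresh // mem_filter => /andP[_ ys].
  have [] := tie_spec xs ds (mkseq tape p) P (s_neq0 _ (updE v')).
  by rewrite -/(x _) xvE // upd_i mem_filter => /andP[/allP/(_ _ ys)].
pose good p' v' := reads A tape (rcons xs (xv v')) ds p p' /\
  decision_optimal (gadget i v') (xv v')
    (decide A (rcons xs (xv v')) ds (mkseq tape p')).
have [||phi phi_inj phiP] := @gadget_pairing i Q.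
- move=> y z Uy Uz yz; have Pyz : P y = P z := priority_alike p state iJ Uy Uz yz.
  by rewrite /Q Pyz (class_key_alike Uy Uz yz).
- move=> v1 v2 y z yg zg /andP[_ /eqP ky] /andP[_ /eqP kz].
  by have [] := class_key_inj yg zg (etrans ky (esym kz)).
have xv_phi v' : xv (phi v') = xv v' by have [_] := phiP v'; apply.
(* Paired variants present the same first item after the same history and tape, hence receive the
   same decision, which is optimal for at most one of them. *)
have half : (2 * #|[pred v' | `[< exists p', good p' v' >]]| <= #|variant|)%N.
  apply: (card_half phi_inj) => v' /= /asboolP[p' [rd opt]].
  apply/asboolP => -[p'']; rewrite /good xv_phi => -[rd' opt'].
  rewrite -(reads_fun rd rd') in opt'.
  apply: opposite_decisions opt opt'; [|exact: (phiP v').1|exact: xv_top|].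
    exact: (priority_fresh p state iJ).
  by rewrite -(xv_phi v') xv_top.
rewrite (cardsD1 i J) iJ /= !expnS.
apply: (card_fibers (i := i) half) => [w|v' /asboolP[p' [rd opt]]].
  move=> /winningP[wE win]; apply/asboolP.
  have [] := wins_first_decision iJ sz _ (s_neq0 _ wE) _ _ win.
  - by move=> y /(seen_fresh state iJ)[i' i'i U'y] Uy;
      rewrite (subuniverse_inj U'y Uy) eqxx in i'i.
  - by have [/(_ i iJ)] := st w wE.
  - exact: xv_gadget.
  by move=> p'; rewrite -/P -/(x w) (xvE w wE); exists p'.
have xv_own : U i (xv v').
  by have := xv_top v'; rewrite mem_filter => /andP[_]; exact: gadget_sub.
have agree_sub w : w \in agree (J :\ i) (upd v') -> w \in agree J w0 /\ w i = v'.
  move=> /agreeP wE; split; last by rewrite wE ?upd_i // !inE eqxx.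
  apply/agreeP => i1 i1J; rewrite wE ?ffunE; last by rewrite !inE (negPf i1J) andbF.
  by case: eqP i1J => // ->; rewrite iJ.
pose ds' := rcons ds (decide A (rcons xs (xv v')) ds (mkseq tape p')).
(* Within the fibre over [v'] the history is common again, so the induction hypothesis applies with
   [i] opened. *)
apply: leq_trans
  (IH (J :\ i) (upd v') (fun w => rem (xv v') (s w)) (rcons xs (xv v')) ds' p' _ _).
- rewrite leq_mul2r; apply/orP; right; apply: subset_leq_card.
  apply/fintype.subsetP => w; rewrite finset.in_set.
  move=> /andP[/winningP[wE win] /eqP wi]; apply/winningP; split.
    apply/agreeP => i1; rewrite !inE negb_and negbK ffunE.
    case: eqP => [-> //|_ /=]; exact: (agreeP _ _ _ wE).
  have := @wins_step J w _ xs ds p p' (s_neq0 _ wE).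
  rewrite /= -/P -/(x w) (xvE w wE) wi => /(_ rd win)[D [q [stp opts]]].
  by exists D, q; split=> // i1 /setD1P[_]; exact: opts.
- split; first by rewrite !size_rcons sz.
    move=> y; rewrite mem_rcons inE => /predU1P[->|/seen[i1 i1J U1]].
      by exists i => //; rewrite !inE eqxx.
    by exists i1 => //; rewrite !inE (negPf i1J) andbF.
  move=> w /agree_sub[wE wi]; have [fresh old items] := st w wE.
  have [fresh' old' _] := st _ (updE v'); split.
  + by move=> i1 /setD1P[i1i i1J]; rewrite (filter_other_own _ i1i xv_own) fresh.
  + move=> i1; rewrite !inE negb_and negbK; have [->|i1i /= i1J] := eqVneq i1 i.
      by rewrite !filter_rem_true ?fresh ?fresh' ?upd_i ?wi //; apply/ownP.
    by rewrite !(filter_other_own _ i1i xv_own) old // old'.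
  + by move=> y /mem_rem; exact: items.
by move=> w /agree_sub[wE wi]; have := size_rem_s w wE; rewrite xvE // wi.
Qed.

End FixedTape.

(** * Complete inputs and optimality on each gadget *)

Local Notation profile := {ffun 'I_m -> variant}.

Definition input (w : profile) : seq (item B) :=
  flatten [seq gadget i (w i) | i <- enum 'I_m].

Lemma input_item w x : x \in input w -> exists i v, x \in gadget i v.
Proof. by move=> /flatten_mapP[i _ xg]; exists i, (w i). Qed.

Lemma input_own w i : [seq x <- input w | own i x] = gadget i (w i).
Proof.
have filter_own i' : [seq x <- gadget i' (w i') | own i x] =
    if i' == i then gadget i' (w i') else [::].
  case: eqVneq => [->|i'i]; first exact/all_filterP/own_gadget.
  apply/eqP; rewrite -[_ == _]negbK -has_filter; apply/hasPn => x /gadget_sub Ux.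
  by apply/ownP => U'x; rewrite (subuniverse_inj Ux U'x) eqxx in i'i.
have filter_enum s : uniq s -> [seq x <- flatten [seq gadget i (w i) | i <- s] | own i x] =
    if i \in s then gadget i (w i) else [::].
  elim: s => //= i' s IH /andP[i's us]; rewrite filter_cat filter_own IH // inE eq_sym.
  by case: eqVneq => [ii'|//]; rewrite ii' in i's *; rewrite (negPf i's) cats0.
by rewrite /input filter_enum ?enum_uniq // mem_enum.
Qed.

Lemma size_input w : (size (input w) <= m * max_pattern_size C)%N.
Proof.
rewrite /input size_flatten /shape -map_comp sumnE big_map big_enum /=.
rewrite -[X in (_ <= X * _)%N]card_ord -sum_nat_const.
by apply: leq_sum => i _; exact: size_gadget.
Qed.

Lemma input_one_gadget_each w : one_gadget_each C U (input w).
Proof. by exists (fun i => gadget i (w i)) => // i; exact: gadget_in_gadget. Qed.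

Lemma perm_own (D : seq (item B * bool)) :
  (forall z, z \in D -> exists i, own i z.1) ->
  perm_eq D (flatten [seq [seq z <- D | own i z.1] | i <- enum 'I_m]).
Proof.
move=> owned; apply/seq.permP => a.
rewrite count_flatten -map_comp sumnE big_map big_enum /=.
elim: D owned => [|z D IH] owned /=; first by rewrite big1.
rewrite IH => [|y yD]; last by apply: owned; rewrite inE yD orbT.
have [i zi] := owned z (mem_head _ _).
rewrite (bigD1 i) //= [RHS](bigD1 i) //= zi /= addnA; congr (_ + _).
apply: eq_bigr => i' i'i; case: ifP => // /ownP Uz.
by rewrite (subuniverse_inj Uz (ownP _ _ zi)) eqxx in i'i.
Qed.

Hypothesis B_additive : Defs.additive C U.

Lemma optimal_gadgets w (D : seq (item B * bool)) : perm_eq (unzip1 D) (input w) ->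
  obj D = OPT (input w) -> forall i, obj [seq z <- D | own i z.1] = OPT (gadget i (w i)).
Proof.
move=> DX Dopt; apply: (optimal_parts (H := fun i => gadget i (w i))).
- by move=> i; exact: gadget_feasible.
- move=> E EH; have := @B_additive [set: 'I_m] E.
  rewrite enum_setT -enumT => -> => [|i _].
    by apply: eq_bigl => i; rewrite inE.
  have [[f bf gf] gU] := gadget_copy i (w i).
  exists (pat (w i).1 (ident x0)); first exact: pat_in_collection.
  split; first by exists f => //; exact: perm_trans (EH i) gf.
  by move=> x; rewrite (perm_mem (EH i)); exact: gU.
- move=> i; rewrite -(input_own w i) (_ : unzip1 _ = [seq x <- unzip1 D | own i x]).
    exact: perm_filter.
  by rewrite /unzip1 filter_map.
(* The solution lists items in order of arrival; regrouping it by subuniverse preserves its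
   value. *)
rewrite -Dopt; apply: obj_perm; rewrite perm_sym; apply: perm_own => z zD.
have : z.1 \in input w by rewrite -(perm_mem DX) (map_f fst zD).
by move=> /input_item[i [v /gadget_sub Uz]]; exists i; apply/ownP.
Qed.

(** * Pigeonhole argument over short tapes *)

Section Pigeonhole.
Variables (A : algorithm B) (O : oracle B).
Hypothesis A_oblivious : oblivious_algorithm (union_universe U) A.
Hypothesis A_optimal : forall w, exists D bits,
  run A tie (O (input w) tie) (input w) D bits /\ obj D = OPT (input w).

Definition solved (tape : nat -> bool) (w : profile) : Prop :=
  exists D bits, run A tie tape (input w) D bits /\ obj D = OPT (input w).

Lemma solved_le tape :
  (#|[set w : profile | `[< solved tape w >]]| * 2 ^ m <= #|variant| ^ m)%N.
Proof.
(* One solved profile is enough to know where the initial reading stops, as this does not depend on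
   the input. *)
have [->|[w0]] := set_0Vmem [set w : profile | `[< solved tape w >]].
  by rewrite cards0.
rewrite inE => /asboolP[D0 [bits0 [[p rd _] _]]].
have state : consistent_state [set: 'I_m] w0 input [::] [::].
  split=> // w _; split=> [i _|i|x]; [exact: input_own | by rewrite inE | exact: input_item].
have := winning_le (n := (m * max_pattern_size C)%N) tape A_oblivious p state
  (fun w _ => size_input w).
rewrite cardsT card_ord; apply: leq_trans; rewrite leq_mul2r; apply/orP; right.
apply: subset_leq_card; apply/fintype.subsetP => w; rewrite inE => /asboolP.
move=> [D [bits [runD Dopt]]]; apply/winningP; split; first by apply/agreeP => i; rewrite inE.
have DX := run_outcome tie_tiebreaker runD; have [p' rd' st] := runD.
rewrite (reads_fun rd rd'); exists D, bits; split=> // i _.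
exact: optimal_gadgets.
Qed.

Lemma many_bits : (0 < m)%N ->
  exists w D bits, run A tie (O (input w) tie) (input w) D bits /\ (m <= bits)%N.
Proof.
move=> m0; apply: contrapT => few.
(* With at most [m.-1] bits read, only that prefix of the tape matters; it is completed by
   [false]. *)
have /choice[t tP] : forall w : profile, exists t : m.-1.-tuple bool,
    solved (nth false t) w.
  move=> w; have [D [bits [runD Dopt]]] := A_optimal w.
  have bits_lt : (bits <= m.-1)%N.
    rewrite -ltnS prednK // ltnNge; apply/negP => mb; apply: few.
    by exists w, D, bits.
  have sz : size (mkseq (O (input w) tie) m.-1) == m.-1 by rewrite size_mkseq.
  exists (Tuple sz), D, bits; split=> //; apply: run_local bits_lt _ runD.
  by rewrite -[LHS](mkseq_nth false) size_mkseq.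
have : (#|{: profile}| * 2 ^ m <= 2 ^ m.-1 * #|variant| ^ m)%N.
  have -> : #|{: profile}| = (\sum_(u : m.-1.-tuple bool) #|[set w | t w == u]|)%N.
    rewrite -sum1_card (partition_big t predT) //.
    by apply: eq_bigr => u _; rewrite -sum1dep_card.
  rewrite big_distrl /= -[X in (X ^ m.-1)%N]card_bool -card_tuple -sum_nat_const.
  apply: leq_sum => u _; apply: leq_trans (solved_le (nth false u)).
  rewrite leq_mul2r; apply/orP; right; apply: subset_leq_card.
  apply/fintype.subsetP => w; rewrite !inE => /eqP <-; apply/asboolP; exact: tP.
(* Cancelling the number of profiles would leave [2 ^ m <= 2 ^ m.-1]. *)
rewrite card_ffun card_ord mulnC leq_pmul2r; last first.
  by rewrite expn_gt0; apply/orP; left; apply/card_gt0P; exists (true, 1%g).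
by rewrite leq_exp2l // -ltnS prednK // ltnn.
Qed.

End Pigeonhole.
End Gadgets.

End AdviceLowerBound.

Theorem theorem7 (R : realType) (B : problem R) (k : nat)
  (C : pattern_pairs B k) (n m : nat)
  (N : 'I_m -> set (name B)) (U : 'I_m -> set (item B))
  (ident : item B -> 'I_k) (opt_a bad_a opt_r bad_r : \bar R)
  (k_gt0 : (0 < k)%N)
  (m_def : m = (n %/ max_pattern_size C)%N)
  (U_sub : forall i, subuniverse C (N i) (U i))
  (B_additive : additive C U)
  (U_consistent : consistency C U)
  (U_first : first_item C U ident)
  (U_decision : distinguishing_decision C U ident)
  (U_disjoint : disjoint_copies N U)
  (U_values : pattern_values C U ident opt_a bad_a opt_r bad_r)
  (opt_ar : (opt_a <= opt_r)%E)
  (A : algorithm B) (O : oracle B)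
  (A_oblivious : oblivious_algorithm (union_universe U) A)
  (A_optimal : optimal (gadget_inputs C U) A O) :
  exists X T D bits,
    [/\ gadget_inputs C U X, is_tiebreaker T, run A T (O X T) X D bits,
        (size X <= n)%N & (n %/ max_pattern_size C <= bits)%N].
Proof.
(* For [m = 0] the bound is trivial, but a run must be exhibited: it is one on the empty input, with
   a pattern item as the default of the tiebreaker. *)
have [m0|m_gt0] := posnP m.
  have one_each : one_gadget_each C U [::].
    exists (fun=> [::]); first by case=> i im; exfalso; rewrite m0 in im.
    by rewrite (size0nil (etrans (size_enum_ord m) m0)).
  have input0 : gadget_inputs C U [::] by split; first exact: U_consistent.
  have := pat_neq0 C true (Ordinal k_gt0).
  case: (pat C true (Ordinal k_gt0)) => // x0 _ _.
  pose T : tiebreaker B := fun _ _ _ s => head x0 s.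
  have tieT : is_tiebreaker T by move=> xs ds adv; exact: head_mem.
  have [D [bits [runD _]]] := A_optimal _ _ input0 tieT.
  by exists [::], T, D, bits; split; rewrite // -m_def m0.
pose i0 := Ordinal m_gt0.
have [x0 [G GP]] := reference_pair U_sub U_first i0 k_gt0.
have [_ _ copies] := U_disjoint.
have /choice[g gP] : forall i, exists g : name B -> name B,
    bijective g /\ U i = (rename g @` U i0)%classic.
  by move=> i; have [g [bg _ Ug]] := copies i0 i; exists g.
have G_copy b := (GP b).1; have x0G b := (GP b).2.
have g_bij i := (gP i).1; have U_g i := (gP i).2.
have inputP (w : {ffun 'I_m -> variant G}) : gadget_inputs C U (input g w).
  have each : one_gadget_each C U (input g w).
    exact (input_one_gadget_each U_sub G_copy g_bij U_g w).
  by split; first exact: U_consistent.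
have tieP := tie_tiebreaker U x0 G.
have [w [D [bits [runD m_le]]]] := many_bits U_sub U_first U_decision U_disjoint
  G_copy x0G g_bij U_g B_additive A_oblivious
  (fun w => A_optimal _ _ (inputP w) tieP) m_gt0.
exists (input g w), (tie U x0 G), D, bits; split=> //; last by rewrite -m_def.
apply: leq_trans (size_input U_sub G_copy g_bij U_g w) _.
by rewrite {1}m_def leq_trunc_div.
Qed.
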